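(* Let $G$ be a finite abelian group of order $n$ and let $\{A_1,A_2\}$ be an $(n,2;k_1,k_2;\ell)$-RWEDF in $G$. Then $\ell=\frac{k_1+k_2}{n-1}$, and either $k_1=k_2=k$ and $\{A_1,A_2\}$ is an $\left(n,2,k,\frac{2k^2}{n-1}\right)$-EDF, or $\{A_1,A_2\}$ is an $\left(n,2;k_1,k_2;\frac{k_1k_2}{n-1},\frac{k_1k_2}{n-1}\right)$-GSEDF.
   Context: $G$ is written additively, $G^*=G\setminus\{0\}$. For pairwise disjoint nonempty subsets $A_1,\dots,A_m$ of $G$ and $\delta\in G^*$, let $N_i(\delta)=|\{(a_i,a_j): a_i\in A_i,\ a_j\in A_j \text{ for some } j\neq i,\ a_i-a_j=\delta\}|$. An $(n,m;k_1,\dots,k_m;\ell)$-RWEDF is a collection of pairwise disjoint subsets with $|A_i|=k_i$ such that $\sum_i \frac{1}{k_i}N_i(\delta)=\ell$ for all $\delta\in G^*$. An $(n,m,k,\lambda)$-EDF is a collection of $m$ pairwise disjoint $k$-subsets with $\sum_i N_i(\delta)=\lambda$ for all $\delta\in G^*$. An $(n,m;k_1,\dots,k_m;\lambda_1,\dots,\lambda_m)$-GSEDF is a collection of pairwise disjoint subsets with $|A_i|=k_i$ and $N_i(\delta)=\lambda_i$ for all $\delta\in G^*$ and all $i$. *)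

(* Defs.v *)
From mathcomp Require Import all_boot all_order all_algebra.

Set Implicit Arguments.
Unset Strict Implicit.
Unset Printing Implicit Defensive.

Import GRing.Theory.
Local Open Scope ring_scope.

Definition ext_diff_count (G : finZmodType) (m : nat) (A : m.-tuple {set G})
    (i : 'I_m) (d : G) : nat :=
  #|[set p : G * G | [&& p.1 \in tnth A i,
                         [exists j, (j != i) && (p.2 \in tnth A j)]
                       & p.1 - p.2 == d]]|.

Definition disjoint_family (G : finZmodType) (n m : nat)
    (A : m.-tuple {set G}) (k : m.-tuple nat) : Prop :=
  [/\ #|G| = n,
      forall i, tnth A i != set0,
      forall i j, i != j -> [disjoint tnth A i & tnth A j]
    & forall i, #|tnth A i| = tnth k i].

(* The parameters ell and lambda below are rational, so that quotients such as
   2k^2/(n-1) can be used as parameters with no integrality side condition. *)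

Definition is_RWEDF (G : finZmodType) (n m : nat) (k : m.-tuple nat)
    (ell : rat) (A : m.-tuple {set G}) : Prop :=
  disjoint_family n A k /\
  forall d : G, d != 0 ->
    \sum_(i < m) (tnth k i)%:R^-1 * (ext_diff_count A i d)%:R = ell.

Definition is_EDF (G : finZmodType) (n m k : nat) (lambda : rat)
    (A : m.-tuple {set G}) : Prop :=
  disjoint_family n A [tuple k | _ < m] /\
  forall d : G, d != 0 ->
    (\sum_(i < m) ext_diff_count A i d)%N%:R = lambda.

Definition is_GSEDF (G : finZmodType) (n m : nat) (k : m.-tuple nat)
    (lambda : m.-tuple rat) (A : m.-tuple {set G}) : Prop :=
  disjoint_family n A k /\
  forall (i : 'I_m) (d : G), d != 0 ->
    (ext_diff_count A i d)%:R = tnth lambda i.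

(* Main.v *)
(** For two sets, swapping the pair [(a1, a2)] gives [N_2(d) = N_1(-d)].
    Summing the defining equation over [d != 0] determines [ell].  Comparing it
    at [d] and at [-d] gives [(N_1(d) - N_1(-d)) (1/k1 - 1/k2) = 0]: if
    [k1 = k2] the equation is the EDF condition, and otherwise
    [N_1(d) = N_1(-d) = N_2(d)], whose value the equation then determines. *)
Require Import Defs.
From mathcomp Require Import all_boot all_order all_algebra.
From mathcomp Require Import ring.
Import GRing.Theory Num.Theory.
Local Open Scope ring_scope.

Lemma forall_ord2 (P : 'I_2 -> Prop) :
  P ord0 -> P ord_max -> forall i, P i.
Proof.
move=> P0 P1 [[|[|//]] lt_i2].
- by rewrite (_ : Ordinal lt_i2 = ord0) //; apply: val_inj.
- by rewrite (_ : Ordinal lt_i2 = ord_max) //; apply: val_inj.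
Qed.

Definition diff_pairs {G : finZmodType} (A B : {set G}) (d : G) : {set G * G} :=
  [set p in setX A B | p.1 - p.2 == d].

(** Swapping the coordinates of a pair is injective and negates its difference. *)
Lemma card_diff_pairsN (G : finZmodType) (A B : {set G}) (d : G) :
  #|diff_pairs B A d| = #|diff_pairs A B (- d)|.
Proof.
have swapI : injective (fun p : G * G => (p.2, p.1)).
  by move=> [? ?] [? ?] [-> ->].
rewrite -(card_imset _ swapI); apply: eq_card => -[a b].
rewrite !inE /=; apply/imsetP/idP => [[[x y]] | /andP[/andP[aA bB] /eqP dE]].
  rewrite !inE /= => /andP[/andP[xB yA] /eqP dE] [-> ->].
  by rewrite xB yA -dE opprB eqxx.
by exists (b, a); rewrite // !inE /= aA bB -opprB dE opprK eqxx.
Qed.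

(** The pairs of [setX A B] are sorted by their difference; the value [0] never occurs, since it
    would give a common element of [A] and [B]. *)
Lemma sum_card_diff_pairs (G : finZmodType) (A B : {set G}) :
  [disjoint A & B] ->
  (\sum_(d : G | d != 0%R) #|diff_pairs A B d| = #|A| * #|B|)%N.
Proof.
move=> dAB; rewrite -cardsX -sum1_card.
rewrite (partition_big (fun p => p.1 - p.2) (fun d => d != 0)) /=.
  apply: eq_bigr => d _; rewrite -sum1_card; apply: eq_bigl => p.
  by rewrite inE.
move=> [a b]; rewrite inE /= => /andP[aA bB]; rewrite subr_eq0.
by apply: contraL bB => /eqP <-; rewrite (disjointFr dAB aA).
Qed.

Lemma ext_diff_count_fst (G : finZmodType) (A B : {set G}) (d : G) :
  ext_diff_count [tuple A; B] ord0 d = #|diff_pairs A B d|.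
Proof.
apply: eq_card => p; rewrite !inE (tnth_nth set0) /= -andbA.
congr (_ && (_ && _)); apply/existsP/idP => [[j] | pB].
  by move: j; apply: forall_ord2; rewrite ?eqxx // (tnth_nth set0).
by exists ord_max; rewrite (tnth_nth set0).
Qed.

(** Keeping the order [A B] at the price of [- d] lets a single counting function serve both
    sets. *)
Lemma ext_diff_count_snd (G : finZmodType) (A B : {set G}) (d : G) :
  ext_diff_count [tuple A; B] ord_max d = #|diff_pairs A B (- d)|.
Proof.
rewrite -card_diff_pairsN.
apply: eq_card => p; rewrite !inE (tnth_nth set0) /= -andbA.
congr (_ && (_ && _)); apply/existsP/idP => [[j] | pA].
  by move: j; apply: forall_ord2; rewrite ?eqxx // (tnth_nth set0).
by exists ord0; rewrite (tnth_nth set0).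
Qed.

Theorem mainTheorem5 (G : finZmodType) (n k1 k2 : nat) (ell : rat)
    (A1 A2 : {set G}) (hn : #|G| = n)
    (hA : is_RWEDF n [tuple k1; k2] ell [tuple A1; A2]) :
  ell = (k1%:R + k2%:R) / (n%:R - 1) /\
  ((exists k : nat, [/\ k1 = k, k2 = k
      & is_EDF n k (2 * k%:R ^+ 2 / (n%:R - 1)) [tuple A1; A2]])
   \/ is_GSEDF n [tuple k1; k2]
        [tuple k1%:R * k2%:R / (n%:R - 1); k1%:R * k2%:R / (n%:R - 1)]
        [tuple A1; A2]).
Proof.
have [dfA hsum] := hA; have [_ A_n0 A_dis A_card] := dfA.
have dA12 : [disjoint A1 & A2].
  by have := A_dis ord0 ord_max isT; rewrite !(tnth_nth set0).
have cA1 : #|A1| = k1.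
  by have := A_card ord0; rewrite (tnth_nth set0) (tnth_nth 0%N).
have cA2 : #|A2| = k2.
  by have := A_card ord_max; rewrite (tnth_nth set0) (tnth_nth 0%N).
have k1_gt0 : (0 < k1)%N.
  by rewrite -cA1 card_gt0; have := A_n0 ord0; rewrite (tnth_nth set0).
have k2_gt0 : (0 < k2)%N.
  by rewrite -cA2 card_gt0; have := A_n0 ord_max; rewrite (tnth_nth set0).
(* Two disjoint nonempty sets give at least two elements, so the denominator [n - 1] is nonzero. *)
have n_gt1 : (1 < n)%N.
  rewrite -hn (leq_trans _ (max_card [in A1 :|: A2])) // cardsU.
  by rewrite (disjoint_setI0 dA12) cards0 subn0 cA1 cA2 (leq_add k1_gt0 k2_gt0).
have k1n0 : k1%:R != 0 :> rat by rewrite pnatr_eq0 -lt0n.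
have k2n0 : k2%:R != 0 :> rat by rewrite pnatr_eq0 -lt0n.
have n1n0 : n%:R - 1 != 0 :> rat by rewrite subr_eq0 pnatr_eq1 gtn_eqF.
(* Here [a d] is $N_1(d)$ and [a (- d)] is $N_2(d)$. *)
pose a d : rat := #|diff_pairs A1 A2 d|%:R.
have aE d : d != 0 -> k1%:R^-1 * a d + k2%:R^-1 * a (- d) = ell.
  move=> /hsum; rewrite big_ord_recl big_ord1.
  rewrite (_ : lift ord0 ord0 = ord_max); last exact: val_inj.
  by rewrite ext_diff_count_fst ext_diff_count_snd !(tnth_nth 0%N).
have sum_a : \sum_(d | d != 0) a d = k1%:R * k2%:R.
  by rewrite -natr_sum sum_card_diff_pairs // cA1 cA2 natrM.
have sum_aN : \sum_(d | d != 0) a (- d) = k1%:R * k2%:R.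
  rewrite -sum_a [RHS](reindex_inj oppr_inj) /=.
  by apply: eq_bigl => d; rewrite oppr_eq0.
have ellE : ell = (k1%:R + k2%:R) / (n%:R - 1).
  (* Both counts have total [k1 * k2], and $(1/k_1 + 1/k_2) k_1 k_2 = k_1 + k_2$; the left side has
     [n - 1] equal terms. *)
  have : \sum_(d : G | d != 0) ell = k1%:R + k2%:R.
    rewrite -(eq_bigr _ aE) big_split /= -!mulr_sumr sum_a sum_aN.
    by field; rewrite k1n0 k2n0.
  rewrite sumr_const cardC1 hn -[_ *+ _]mulr_natr -subn1 natrB 1?ltnW // => <-.
  by field.
split=> //.
have [eqk | neqk] := eqVneq k1 k2.
  left; exists k1; split=> //; split.
    split=> // i; rewrite tnth_mktuple.
    by move: i; apply: forall_ord2; rewrite (tnth_nth set0) //= cA2.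
  move=> d dn0; rewrite big_ord_recl big_ord1.
  rewrite (_ : lift ord0 ord0 = ord_max); last exact: val_inj.
  rewrite ext_diff_count_fst ext_diff_count_snd natrD -/(a d) -/(a (- d)).
  (* With equal sizes the common weight $1/k_1$ factors out, and solving for [a d + a (- d)]
     multiplies $2k_1/(n-1)$ by $k_1$. *)
  have := aE d dn0; rewrite ellE -eqk -mulrDr => /(canRL (mulKf _)) ->.
    by field; rewrite n1n0.
  by rewrite invr_eq0.
right; split=> //.
have a_sym d : d != 0 -> a (- d) = a d.
  move=> dn0; have := aE (- d); rewrite oppr_eq0 opprK => /(_ dn0).
  rewrite -(aE d dn0) => /eqP; rewrite -subr_eq0.
  have -> : k1%:R^-1 * a (- d) + k2%:R^-1 * a d -
      (k1%:R^-1 * a d + k2%:R^-1 * a (- d)) =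
      (k1%:R^-1 - k2%:R^-1) * (a (- d) - a d) by ring.
  (* As [k1] and [k2] differ, so do their inverses, and the other factor must vanish. *)
  rewrite mulf_eq0 !subr_eq0 (inj_eq invr_inj) eqr_nat (negPf neqk) /=.
  by move/eqP.
have a_val d : d != 0 -> a d = k1%:R * k2%:R / (n%:R - 1).
  move=> dn0; have := aE d dn0; rewrite a_sym // ellE => h.
  have k12n0 : k1%:R + k2%:R != 0 :> rat.
    by rewrite -natrD pnatr_eq0 -lt0n addn_gt0 k1_gt0.
  (* After multiplication by [k1 + k2], the left side is [k1 * k2] times the weighted sum, that is
     $k_1 k_2 \ell$. *)
  apply: (mulfI k12n0).
  transitivity (k1%:R * k2%:R * (k1%:R^-1 * a d + k2%:R^-1 * a d)).
    by field; rewrite k1n0 k2n0.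
  by rewrite h; field.
apply: forall_ord2 => d dn0; rewrite (tnth_nth 0) /=.
- by rewrite ext_diff_count_fst; apply: a_val.
- by rewrite ext_diff_count_snd -/(a (- d)) a_sym ?a_val.
Qed.
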